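(* Let $(A_n)_{n\ge1},(B_n)_{n\ge1},(C_n)_{n\ge1},(D_n)_{n\ge1}$ be the sequences associated with the anti-Tribonacci sequence $(D_n)$. Then for all $n\ge 1$: $$0\le 10n-6-3A_n\le 2,$$ $$0\le 10n-2-3B_n\le 3,$$ $$0\le 10n+1-3C_n\le 3,$$ $$0\le 10n-3-D_n\le 2.$$
   Context: For a set $S$ of positive integers, $\mathrm{mex}(S)$ denotes the smallest positive integer not in $S$. The sequences are defined recursively as follows: $A_1=1$, $B_1=2$, $C_1=3$, $D_1=6$, and for $n\ge 1$, with $S_n=\{A_i,B_i,C_i,D_i: 1\le i\le n\}$, one sets $A_{n+1}=\mathrm{mex}(S_n)$, $B_{n+1}=\mathrm{mex}(S_n\cup\{A_{n+1}\})$, $C_{n+1}=\mathrm{mex}(S_n\cup\{A_{n+1},B_{n+1}\})$, and $D_{n+1}=A_{n+1}+B_{n+1}+C_{n+1}$. The $D_n$ are the anti-Tribonacci numbers $6,16,27,36,46,57,66,75,87,96,\ldots$ (OEIS A265389). *)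

(* Defs.v *)
From mathcomp Require Import all_boot.

Set Implicit Arguments.
Unset Strict Implicit.
Unset Printing Implicit Defensive.

Lemma mex_subproof (s : seq nat) : exists n, (0 < n) && (n \notin s).
Proof.
exists (\max_(i <- s) i).+1; apply/negP => smax.
by have := @leq_bigmax_seq _ s xpredT id _ smax isT; rewrite ltnn.
Qed.

(* A finite set of positive integers is represented by any list enumerating
   it; the order and the repetitions are irrelevant. *)
Definition mex (s : seq nat) : nat := ex_minn (mex_subproof s).

Definition terms_upto (A B C D : nat -> nat) (n : nat) : seq nat :=
  flatten [seq [:: A i; B i; C i; D i] | i <- iota 1 n].

(* Sequences are indexed from 1; the values at 0 are unconstrained. *)
Record anti_tribonacci (A B C D : nat -> nat) : Prop := AntiTribonacci {
  antitrib_A1 : A 1 = 1;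
  antitrib_B1 : B 1 = 2;
  antitrib_C1 : C 1 = 3;
  antitrib_D1 : D 1 = 6;
  antitrib_AS : forall n, 1 <= n ->
    A n.+1 = mex (terms_upto A B C D n);
  antitrib_BS : forall n, 1 <= n ->
    B n.+1 = mex (A n.+1 :: terms_upto A B C D n);
  antitrib_CS : forall n, 1 <= n ->
    C n.+1 = mex [:: A n.+1, B n.+1 & terms_upto A B C D n];
  antitrib_DS : forall n, 1 <= n ->
    D n.+1 = A n.+1 + B n.+1 + C n.+1
}.

Lemma anti_tribonacci_ex : exists A B C D, anti_tribonacci A B C D.
Proof.
pose next s := let a := mex s in let b := mex (a :: s) in
  let c := mex [:: a, b & s] in [:: a; b; c; a + b + c].
pose h := fix h n := if n is m.+1 then h m ++ next (h m) else [:: 1; 2; 3; 6].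
pose q n := if n is m.+2 then next (h m) else [:: 1; 2; 3; 6].
pose T k n := nth 0 (q n) k.
have hE n : terms_upto (T 0) (T 1) (T 2) (T 3) n.+1 = h n.
  elim: n => [//|n IHn]; rewrite /terms_upto -(addn1 n.+1) iotaD map_cat flatten_cat.
  by rewrite [flatten _]IHn.
exists (T 0), (T 1), (T 2), (T 3).
by split=> // -[//|n] _; rewrite ?hE.
Qed.

(* Main.v *)
Require Import Defs.
From mathcomp Require Import all_boot all_order all_algebra.
From mathcomp Require Import zify.
Import Order.TTheory GRing.Theory Num.Theory.
Local Open Scope ring_scope.

(** Cut the positive integers into blocks of ten. The bounds on [D] put exactly
    one [D]-value, [D k.+1], in the block [10k+1 .. 10k+10], at position 5, 6
    or 7. The other nine positions are filled in order by three consecutive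
    triples [(A, B, C)], at positions 1,2,3, then at the elements of 4..7 other
    than [D k.+1], then at 8,9,10. The three triples therefore have sums
    [30k+6], [30k+22 - (D k.+1 - 10k)] and [30k+27], which are again within the
    bounds for [D (3k+1)], [D (3k+2)], [D (3k+3)]; induct on [k]. *)

Section AntiTribonacci.
Local Open Scope nat_scope.

Lemma mexP (s : seq nat) (v : nat) :
  0 < v -> v \notin s -> (forall w, 0 < w < v -> w \in s) -> mex s = v.
Proof.
move=> v0 vs below; rewrite /mex; case: ex_minnP => m /andP[m0 ms] min_m.
apply/eqP; rewrite eqn_leq min_m ?v0 //= leqNgt; apply/negP => mv.
by rewrite below ?m0 in ms.
Qed.

Variables A B C D : nat -> nat.
Hypothesis hABCD : anti_tribonacci A B C D.

Notation S := (terms_upto A B C D).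

Lemma terms_upto0 : S 0 = [::].
Proof. by []. Qed.

Lemma mem_terms_uptoS n w : (w \in S n.+1) =
  (w \in S n) || [|| w == A n.+1, w == B n.+1, w == C n.+1 | w == D n.+1].
Proof.
by rewrite /terms_upto -[in LHS](addn1 n) iotaD map_cat flatten_cat mem_cat
  /= add1n !inE.
Qed.

(* The four initial values also satisfy the recurrence at [n = 0], where
   [S 0] is empty. *)
Lemma next_triple n v1 v2 v3 : 0 < v1 -> v1 < v2 -> v2 < v3 ->
  v1 \notin S n -> v2 \notin S n -> v3 \notin S n ->
  (forall w, 0 < w < v3 -> [|| w == v1, w == v2 | w \in S n]) ->
  [/\ A n.+1 = v1, B n.+1 = v2, C n.+1 = v3 & D n.+1 = v1 + v2 + v3].
Proof.
move=> v1_gt0 lt12 lt23 v1S v2S v3S fill.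
have A_mex : A n.+1 = mex (S n).
  case: n {v1S v2S v3S fill} => [|n]; last exact: (antitrib_AS hABCD).
  by rewrite (antitrib_A1 hABCD); apply/esym/mexP => // w; lia.
have B_mex : B n.+1 = mex (A n.+1 :: S n).
  case: n {v1S v2S v3S fill A_mex} => [|n]; last exact: (antitrib_BS hABCD).
  rewrite (antitrib_B1 hABCD) (antitrib_A1 hABCD).
  by apply/esym/mexP => // w; rewrite inE; lia.
have C_mex : C n.+1 = mex [:: A n.+1, B n.+1 & S n].
  case: n {v1S v2S v3S fill A_mex B_mex} => [|n].
    rewrite (antitrib_C1 hABCD) (antitrib_B1 hABCD) (antitrib_A1 hABCD).
    by apply/esym/mexP => // w; rewrite !inE; lia.
  exact: (antitrib_CS hABCD).
have DE : D n.+1 = A n.+1 + B n.+1 + C n.+1.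
  case: n {v1S v2S v3S fill A_mex B_mex C_mex} => [|n].
    by rewrite (antitrib_D1 hABCD) (antitrib_C1 hABCD) (antitrib_B1 hABCD)
      (antitrib_A1 hABCD).
  exact: (antitrib_DS hABCD).
have Av : A n.+1 = v1.
  rewrite A_mex; apply: mexP => // w w_lt.
  by have /or3P[/eqP|/eqP|] := fill w ltac:(lia); [lia|lia|].
have Bv : B n.+1 = v2.
  rewrite B_mex Av; apply: mexP => [|| w w_lt]; rewrite ?inE ?negb_or ?v2S; try lia.
  by have /or3P[->|/eqP|->] := fill w ltac:(lia); [|lia|rewrite orbT].
have Cv : C n.+1 = v3.
  rewrite C_mex Av Bv; apply: mexP => [|| w w_lt]; rewrite ?inE ?negb_or ?v3S;
    try lia.
  exact: fill.
by split=> //; rewrite DE Av Bv Cv.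
Qed.

(** Terms are moved across the inequalities so that truncated subtraction on [nat] never occurs. *)
Definition term_bounds i :=
  [/\ 3 * A i + 6 <= 10 * i <= 3 * A i + 8,
      3 * B i + 2 <= 10 * i <= 3 * B i + 5,
      3 * C i <= 10 * i + 1 <= 3 * C i + 3 &
      D i + 3 <= 10 * i <= D i + 5].

Definition bounded_upto n := forall i, 0 < i <= n -> term_bounds i.

(** The two alternatives may overlap: inside a block [k] stays fixed even after [u] has passed
    [D k.+1]. *)
Definition filled k n u := forall w,
  w \in S n <-> 0 < w <= u \/ exists2 i, k < i <= n & w = D i.

Lemma bounded_uptoS n :
  bounded_upto n -> term_bounds n.+1 -> bounded_upto n.+1.
Proof.
move=> bnd bndS i; case: (eqVneq i n.+1) => [-> //|i_neq i_le].
by apply: bnd; lia.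
Qed.

Lemma bounded_D n i : bounded_upto n -> 0 < i <= n ->
  D i + 3 <= 10 * i <= D i + 5.
Proof. by move=> bnd /bnd[]. Qed.

(** Since [k <= n], the new [D n.+1] falls under the second alternative wherever it lies, and
    [D k.+1] is already a term; for [n = k] the two coincide. *)
Lemma filled_step k n u u' : k <= n -> u <= u' -> filled k n u ->
  (forall w, u < w <= u' ->
     [|| w == A n.+1, w == B n.+1, w == C n.+1 | w == D k.+1]) ->
  0 < A n.+1 <= u' -> 0 < B n.+1 <= u' -> 0 < C n.+1 <= u' ->
  filled k n.+1 u'.
Proof.
move=> kn uu' fl new Au Bu Cu w; rewrite mem_terms_uptoS; split.
  case/orP => [/fl[w_le|[i i_le ->]]|].
  - by left; lia.
  - by right; exists i => //; lia.
  case/or4P => /eqP ->; [by left|by left|by left|].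
  by right; exists n.+1 => //; lia.
have inD i : k < i <= n.+1 -> w = D i ->
    (w \in S n) || [|| w == A n.+1, w == B n.+1, w == C n.+1 | w == D n.+1].
  move=> i_le wD; case: (eqVneq i n.+1) => [iE|i_neq].
    by rewrite wD iE eqxx !orbT.
  suff -> : w \in S n by [].
  by apply/fl; right; exists i => //; lia.
case=> [w_le|[i i_le wD]]; last exact: inD wD.
case: (leqP w u) => [wu|uw].
  suff -> : w \in S n by [].
  by apply/fl; left; lia.
have /or4P[->|->|->|/eqP] := new w ltac:(lia); rewrite ?orbT //.
by apply: inD; lia.
Qed.

(** The bounds give [D i >= 10 * i - 5], hence at least [10 * k + 15] for [i >= k + 2], so [D k.+1]
    is the only term that [v] could hit. *)
Lemma filled_notin k n u v : bounded_upto n -> filled k n u -> u < v ->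
  v < 10 * k + 15 -> (k < n -> v != D k.+1) -> v \notin S n.
Proof.
move=> bnd fl uv v_lt vD; apply/negP => /fl[|[i i_le vE]]; first by lia.
have := bounded_D _ i bnd ltac:(lia).
case: (eqVneq i k.+1) => [iE|]; last by lia.
by move: vD; rewrite vE iE eqxx; lia.
Qed.

Lemma block_step k : bounded_upto (3 * k) -> filled k (3 * k) (10 * k) ->
  bounded_upto (3 * k.+1) /\ filled k.+1 (3 * k.+1) (10 * k.+1).
Proof.
move=> bnd0 fl0.
(* The condition [k < 3 * k] fails only for [k = 0], when no [D] exists yet. *)
have D_gt v : v < 10 * k + 5 -> k < 3 * k -> v != D k.+1.
  by move=> v_lt k_lt; have := bounded_D _ k.+1 bnd0 ltac:(lia); lia.
have [] := next_triple (3 * k) (10 * k + 1) (10 * k + 2) (10 * k + 3).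
- by lia.
- by lia.
- by lia.
- by apply: filled_notin bnd0 fl0 _ _ (D_gt _ _); lia.
- by apply: filled_notin bnd0 fl0 _ _ (D_gt _ _); lia.
- by apply: filled_notin bnd0 fl0 _ _ (D_gt _ _); lia.
- move=> w w_lt; case: (leqP w (10 * k)) => w_le; last by lia.
  by apply/or3P/Or33; apply/fl0; left; lia.
move=> A1 B1 C1 D1.
have bnd1 : bounded_upto (3 * k).+1.
  by apply: bounded_uptoS => //; split; lia.
have fl1 : filled k (3 * k).+1 (10 * k + 3).
  by apply: filled_step fl0 _ _ _ _ => [||w w_lt|||]; lia.
(* Now [k + 1 <= 3 * k + 1] holds even for [k = 0], where the first triple has just produced
   [D 1]. *)
have Dk := bounded_D _ k.+1 bnd1 ltac:(lia).
have DkS : D k.+1 \in S (3 * k).+1.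
  by apply/fl1; right; exists k.+1; lia.
(* [b < c] are the elements of [10k+5, 10k+6, 10k+7] other than [D k.+1]. These three numbers add up
   to [30k+18], so only the order and this sum are kept. *)
pose b := if D k.+1 == 10 * k + 5 then 10 * k + 6 else 10 * k + 5.
pose c := if D k.+1 == 10 * k + 7 then 10 * k + 6 else 10 * k + 7.
have bE : b = if D k.+1 == 10 * k + 5 then 10 * k + 6 else 10 * k + 5 by [].
have cE : c = if D k.+1 == 10 * k + 7 then 10 * k + 6 else 10 * k + 7 by [].
clearbody b c.
have bcD : [/\ 10 * k + 4 < b, b < c & c <= 10 * k + 7] /\
    [/\ b != D k.+1, c != D k.+1 & b + c + D k.+1 = 30 * k + 18].
  by move: bE cE; case: eqP => ?; case: eqP => ?; split; split; lia.
case: bcD {bE cE} => -[b_gt bc c_le] [bD cD bcD].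
have [] := next_triple (3 * k).+1 (10 * k + 4) b c.
- by lia.
- by lia.
- by lia.
- by apply: filled_notin bnd1 fl1 _ _ _; lia.
- by apply: filled_notin bnd1 fl1 _ _ _; lia.
- by apply: filled_notin bnd1 fl1 _ _ _; lia.
- move=> w w_lt; case: (leqP w (10 * k + 3)) => w_le.
    by apply/or3P/Or33; apply/fl1; left; lia.
  case: (eqVneq w (D k.+1)) => [->|w_neq]; first by rewrite DkS !orbT.
  by lia.
move=> A2 B2 C2 D2.
have bnd2 : bounded_upto (3 * k).+2.
  by apply: bounded_uptoS => //; split; lia.
have fl2 : filled k (3 * k).+2 (10 * k + 7).
  by apply: filled_step fl1 _ _ _ _ => [||w w_lt|||]; lia.
have [] := next_triple (3 * k).+2 (10 * k + 8) (10 * k + 9) (10 * k + 10).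
- by lia.
- by lia.
- by lia.
- by apply: filled_notin bnd2 fl2 _ _ _; lia.
- by apply: filled_notin bnd2 fl2 _ _ _; lia.
- by apply: filled_notin bnd2 fl2 _ _ _; lia.
- move=> w w_lt; case: (leqP w (10 * k + 7)) => w_le; last by lia.
  by apply/or3P/Or33; apply/fl2; left; lia.
move=> A3 B3 C3 D3.
have bnd3 : bounded_upto (3 * k).+3.
  by apply: bounded_uptoS => //; split; lia.
have fl3 : filled k (3 * k).+3 (10 * k + 10).
  by apply: filled_step fl2 _ _ _ _ => [||w w_lt|||]; lia.
have -> : 3 * k.+1 = (3 * k).+3 by lia.
have -> : 10 * k.+1 = 10 * k + 10 by lia.
(* [D k.+1] lies in the completed block, so it can leave the second alternative and the counter
   moves to [k.+1]. *)
split=> // w; split=> [/fl3[w_le|[i i_le wD]]|[w_le|[i i_le wD]]].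
- by left.
- case: (eqVneq i k.+1) => [iE|i_neq]; first by left; rewrite wD iE; lia.
  by right; exists i => //; lia.
- by apply/fl3; left.
- by apply/fl3; right; exists i => //; lia.
Qed.

Lemma all_term_bounds n : 0 < n -> term_bounds n.
Proof.
have blocks k : bounded_upto (3 * k) /\ filled k (3 * k) (10 * k).
  elim: k => [|k [bnd fl]]; last exact: block_step.
  split=> [i|w]; first by lia.
  by rewrite muln0 terms_upto0; split=> // -[|[i]]; lia.
(* As [n <= 3 * n], the first [n] blocks already cover index [n]. *)
by move=> n_gt0; have [bnd _] := blocks n; apply: bnd; lia.
Qed.

End AntiTribonacci.

Theorem mainTheorem4 (A B C D : nat -> nat) (hABCD : anti_tribonacci A B C D)
    (n : nat) (hn : (1 <= n)%N) :
  [/\ 0 <= 10 * n%:Z - 6 - 3 * (A n)%:Z <= 2,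
      0 <= 10 * n%:Z - 2 - 3 * (B n)%:Z <= 3,
      0 <= 10 * n%:Z + 1 - 3 * (C n)%:Z <= 3 &
      0 <= 10 * n%:Z - 3 - (D n)%:Z <= 2].
Proof.
by have [*] := all_term_bounds _ _ _ _ hABCD n hn; split; lia.
Qed.
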